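(* Assume $\kappa=\kappa^{<\kappa}$. For every $x\in S_\kappa$, the Stone–Čech remainder $(S_\kappa\setminus\{x\})^*$ has cardinality $2^{2^\kappa}$.
   Context: A space is zero-dimensional if it has a base of clopen sets. For a zero-dimensional space $X$ and an open $U\subseteq X$, the ($X$-)type $\tau(U)$ is the least cardinal $\tau$ such that $U$ is a union of $\tau$ many clopen subsets of $X$. A zero-dimensional space is an $F_\kappa$-space if every open subset of type less than $\kappa$ is $C^*$-embedded (every bounded continuous real-valued function on it extends continuously to the whole space). A space is a $G_\kappa$-space if every non-empty intersection of fewer than $\kappa$ open sets has non-empty interior. A $\kappa$-Parovičenko space is a compact Hausdorff zero-dimensional $F_\kappa$- and $G_\kappa$-space without isolated points (no weight restriction is imposed). If $\kappa=\kappa^{<\kappa}$ there is, up to homeomorphism, a unique $\kappa$-Parovičenko space of weight $\kappa$; it is denoted $S_\kappa$. For a Tychonoff space $X$, $X^*=\beta X\setminus X$. *)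

(* Defs.v *)
From Stdlib Require Import Reals List.

Record TopSpace := {
  carrier :> Type;
  open : (carrier -> Prop) -> Prop;
  open_full : open (fun _ => True);
  open_union : forall F : (carrier -> Prop) -> Prop,
      (forall U, F U -> open U) -> open (fun x => exists U, F U /\ U x);
  open_inter : forall U V, open U -> open V -> open (fun x => U x /\ V x)
}.
Arguments open {t} _.

Definition sub_open (X : TopSpace) (A : X -> Prop) (V : {x : X | A x} -> Prop) : Prop :=
  exists U : X -> Prop, open U /\ forall y, V y <-> U (proj1_sig y).

Lemma sub_open_full (X : TopSpace) (A : X -> Prop) : sub_open X A (fun _ => True).
Proof. exists (fun _ => True); split; [apply open_full | tauto]. Qed.

Lemma sub_open_union (X : TopSpace) (A : X -> Prop)
  (F : ({x : X | A x} -> Prop) -> Prop) :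
  (forall V, F V -> sub_open X A V) -> sub_open X A (fun y => exists V, F V /\ V y).
Proof.
  intros hF.
  exists (fun x => exists U, (open U /\ forall y : {x : X | A x},
             U (proj1_sig y) -> exists V, F V /\ V y) /\ U x).
  split.
  - apply open_union. intros U [hU _]. exact hU.
  - intros y; split.
    + intros [V [hV Vy]]. destruct (hF V hV) as [U [hU hUV]].
      exists U; split; [split; [exact hU|] | apply hUV; exact Vy].
      intros y' hy'. exists V; split; [exact hV | apply hUV; exact hy'].
    + intros [U [[_ hU] Uy]]. apply hU; exact Uy.
Qed.

Lemma sub_open_inter (X : TopSpace) (A : X -> Prop) (V W : {x : X | A x} -> Prop) :
  sub_open X A V -> sub_open X A W -> sub_open X A (fun y => V y /\ W y).
Proof.
  intros [U [hU hV]] [U' [hU' hW]].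
  exists (fun x => U x /\ U' x); split; [apply open_inter; assumption|].
  intros y; rewrite hV, hW; tauto.
Qed.

Definition subspace (X : TopSpace) (A : X -> Prop) : TopSpace :=
  {| carrier := {x : X | A x};
     open := sub_open X A;
     open_full := sub_open_full X A;
     open_union := sub_open_union X A;
     open_inter := sub_open_inter X A |}.

Definition closed {X : TopSpace} (U : X -> Prop) : Prop := open (fun x => ~ U x).
Definition clopen {X : TopSpace} (U : X -> Prop) : Prop := open U /\ closed U.

Definition is_base (X : TopSpace) (B : (X -> Prop) -> Prop) : Prop :=
  (forall U, B U -> open U) /\
  forall (U : X -> Prop) (x : X), open U -> U x ->
    exists V, B V /\ V x /\ forall y, V y -> U y.

Definition zero_dimensional (X : TopSpace) : Prop := is_base X (@clopen X).

Definition hausdorff (X : TopSpace) : Prop :=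
  forall x y : X, x <> y -> exists U V : X -> Prop,
    open U /\ open V /\ U x /\ V y /\ forall z, ~ (U z /\ V z).

Definition compact (X : TopSpace) : Prop :=
  forall F : (X -> Prop) -> Prop, (forall U, F U -> open U) ->
    (forall x, exists U, F U /\ U x) ->
    exists l : list (X -> Prop), (forall U, In U l -> F U) /\
      forall x, exists U, In U l /\ U x.

Definition isolated {X : TopSpace} (x : X) : Prop := open (fun y => y = x).

Definition le_card (A B : Type) : Prop :=
  exists f : A -> B, forall a a', f a = f a' -> a = a'.
Definition lt_card (A B : Type) : Prop := le_card A B /\ ~ le_card B A.
Definition eq_card (A B : Type) : Prop :=
  exists f : A -> B, (forall a a', f a = f a' -> a = a') /\ (forall b, exists a, f a = b).

Definition continuous_real {X : TopSpace} (f : X -> R) : Prop :=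
  forall W : R -> Prop, open_set W -> open (fun p => W (f p)).
Definition bounded_real {X : Type} (f : X -> R) : Prop :=
  exists M : R, forall p, (Rabs (f p) <= M)%R.

Definition C_star_embedded (X : TopSpace) (A : X -> Prop) : Prop :=
  forall f : subspace X A -> R, continuous_real f -> bounded_real f ->
    exists g : X -> R, continuous_real g /\ forall y, g (proj1_sig y) = f y.

(** The cardinal κ is represented by a type K (κ = |K|). *)
Definition type_lt (X : TopSpace) (U : X -> Prop) (K : Type) : Prop :=
  exists (I : Type) (c : I -> X -> Prop), lt_card I K /\
    (forall i, clopen (c i)) /\ forall x, U x <-> exists i, c i x.

Definition F_kappa_space (X : TopSpace) (K : Type) : Prop :=
  zero_dimensional X /\
  forall U : X -> Prop, open U -> type_lt X U K -> C_star_embedded X U.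

Definition G_kappa_space (X : TopSpace) (K : Type) : Prop :=
  forall (I : Type) (O : I -> X -> Prop), lt_card I K ->
    (forall i, open (O i)) -> (exists x, forall i, O i x) ->
    exists V : X -> Prop, open V /\ (exists x, V x) /\
      forall x, V x -> forall i, O i x.

Definition kappa_Parovicenko (X : TopSpace) (K : Type) : Prop :=
  compact X /\ hausdorff X /\ zero_dimensional X /\
  F_kappa_space X K /\ G_kappa_space X K /\ (forall x : X, ~ isolated x).

Definition has_weight (X : TopSpace) (K : Type) : Prop :=
  (exists B, is_base X B /\ le_card {U : X -> Prop | B U} K) /\
  (forall B, is_base X B -> le_card K {U : X -> Prop | B U}).

Definition kappa_eq_kappa_lt (K : Type) : Prop :=
  le_card nat K /\ forall I : Type, lt_card I K -> le_card (I -> K) K.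

Definition is_stone_cech (Y Z : TopSpace) (e : Y -> Z) : Prop :=
  compact Z /\ hausdorff Z /\
  (forall y y', e y = e y' -> y = y') /\
  (forall W, open W -> open (fun y => W (e y))) /\
  (forall V, open V -> exists W, open W /\ forall y, V y <-> W (e y)) /\
  (forall W : Z -> Prop, open W -> (exists z, W z) -> exists y, W (e y)) /\
  (forall f : Y -> R, continuous_real f -> bounded_real f ->
     exists g : Z -> R, continuous_real g /\ forall y, g (e y) = f y).

(* Main.v *)
(* Upper bound: a point z of the remainder is determined by the family of
   subsets of a dense set of size κ having z in their closure. Lower bound:
   by recursion on κ, the G_κ property yields nonempty compact open sets W_a in
   X \ {x} that leave every compact subset of X \ {x}, and the F_κ property
   (disjoint open sets of type < κ are separated by a clopen set) yields, for
   every S ⊆ κ, a clopen subset of X \ {x} containing W_a for a ∈ S and missing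
   W_a for a ∉ S. Taking S in an independent family of 2^κ subsets of κ gives
   2^κ clopen subsets of X \ {x} all of whose finite Boolean combinations have
   x in their closure, so by compactness each of the 2^(2^κ) patterns is
   realised by a point of the remainder. *)

From mathcomp Require Import ssreflect ssrfun ssrbool eqtype.
From mathcomp Require Import boolp classical_sets functions cardinality wochoice.
From Stdlib Require Import Reals List Lra Classical ClassicalEpsilon Wellfounded.
Require Import Defs.

(** * Cardinal comparison and well-orders with small initial segments *)

Lemma le_card_trans {A B C : Type} : le_card A B -> le_card B C -> le_card A C.
Proof.
move=> [f fI] [g gI]; exists (fun a => g (f a)) => a a' /gI; exact: fI.
Qed.

Lemma le_card_prod (A B A' B' : Type) :
  le_card A A' -> le_card B B' -> le_card (A * B) (A' * B').
Proof.
move=> [f fI] [g gI]; exists (fun p => (f p.1, g p.2)).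
by move=> [a b] [a' b'] [/fI -> /gI ->].
Qed.

Lemma le_card_list (A B : Type) : le_card A B -> le_card (list A) (list B).
Proof.
move=> [f fI]; exists (List.map f).
by elim=> [|a l IH] [|a' l'] //= [/fI -> /IH ->].
Qed.

Lemma le_card_retraction {A B : Type} (a0 : A) (f : A -> B) :
  (forall a a', f a = f a' -> a = a') -> exists g : B -> A, forall a, g (f a) = a.
Proof.
move=> fI; exists (fun b => epsilon (inhabits a0) (fun a => f a = b)) => a.
by apply: fI; apply: (epsilon_spec (inhabits a0) (fun a' => f a' = f a)); exists a.
Qed.

Lemma le_card_subset (K : Type) (P : K -> Prop) : le_card {k | P k} K.
Proof.
by exists (@proj1_sig K P) => -[a Pa] [b Pb] /= ab; apply: eq_exist.
Qed.

Lemma le_card_antisym (A B : Type) : le_card A B -> le_card B A -> eq_card A B.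
Proof.
have sub (T U : Type) : le_card T U -> card_le [set: T]%classic [set: U]%classic.
  move=> [f fI]; have : card_eq [set f t | t in [set: T]]%classic [set: T]%classic.
    by apply: inj_card_eq => t t' _ _ /fI.
  rewrite card_eq_le => /andP[_ fT]; apply: (card_le_trans fT).
  exact: subset_card_le.
move=> /sub AB /sub BA.
have /card_bijP[f [g fK gK]] := Cantor_Bernstein AB BA.
exists (fun a => set_val (f (SigSub (in_setT a)))); split.
  move=> a a' /val_inj/(can_inj fK); exact: (congr1 set_val).
move=> b; exists (set_val (g (SigSub (in_setT b)))).
have -> : SigSub (in_setT (set_val (g (SigSub (in_setT b))))) = g (SigSub (in_setT b)).
  exact: val_inj.
by rewrite gK.
Qed.

(** Start from any well-order of [K]. If some initial segment has full size, take the least [a]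
    bounding such a segment and pull the order back along an injection of [K] into it: the new
    segments embed in segments below points smaller than [a], which are small by minimality. *)
Lemma exists_initial_well_order (K : Type) :
  exists lt : K -> K -> Prop, well_founded lt /\
    (forall a b, lt a b \/ a = b \/ lt b a) /\
    forall a, lt_card {b | lt b a} K.
Proof.
have [R Rwo] := well_ordering_principle {classic K}.
have min (P : K -> Prop) : (exists a, P a) -> exists2 a, P a & forall b, P b -> R a b.
  move=> [a Pa]; have [|m [[mP mlb] _]] := Rwo (fun a => `[< P a >]).
    by exists a; apply/asboolP.
  by exists m; [exact/asboolP|move=> b Pb; apply: mlb; apply/asboolP].
pose lt0 a b := ~~ R b a.
have lt0_min (P : K -> Prop) : (exists a, P a) -> exists2 a, P a & forall b, lt0 b a -> ~ P b.
  move=> /min[a Pa aP]; exists a => // b /negP ab Pb; exact/ab/aP.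
have lt0_wf : well_founded lt0.
  move=> a; apply: NNPP => /(ex_intro (fun a => ~ Acc lt0 a) a)/lt0_min[b bN bP].
  by apply: bN; constructor=> c /bP/NNPP.
have lt0_tot a b : lt0 a b \/ a = b \/ lt0 b a.
  case: (boolP (R b a)) => [ba|]; last by left.
  case: (boolP (R a b)) => [ab|]; last by right; right.
  (* Here [R a b] and [R b a] both hold, so [a] and [b] are both minima of the pair, and minima are
     unique. *)
  right; left; have [|m [_ mU]] := Rwo (fun c => `[< c = a \/ c = b >]).
    by exists a; apply/asboolP; left.
  have raa c : R c c.
    have [|m' [[/asboolP mc mm] _]] := Rwo (fun d => `[< d = c >]).
      by exists c; apply/asboolP.
    by rewrite -{1}mc; apply: mm; apply/asboolP.
  have mE c : c = a \/ c = b -> m = c.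
    by move=> hc; apply: mU; split=> [|d /asboolP]; [exact/asboolP|case: hc => -> [] ->].
  by rewrite -(mE a (or_introl erefl)); exact: mE (or_intror erefl).
have initial lt (hw : well_founded lt) (ht : forall a b, lt a b \/ a = b \/ lt b a) :
    (forall a : K, ~ le_card K {b | lt b a}) ->
    exists lt : K -> K -> Prop, well_founded lt /\
    (forall a b, lt a b \/ a = b \/ lt b a) /\ forall a, lt_card {b | lt b a} K.
  move=> h; exists lt; split=> //; split=> // a; split; [exact: le_card_subset|exact: h].
case: (classic (exists a, le_card K {b | lt0 b a})) => [/lt0_min[a [f fI] amin]|N].
- pose g k := proj1_sig (f k).
  have gI k k' : g k = g k' -> k = k'.
    by rewrite /g => e; apply: fI; move: (f k) (f k') e => [u hu] [v hv] /= e; apply: eq_exist.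
  apply: (initial (fun b c => lt0 (g b) (g c))).
  + exact: (wf_inverse_image _ _ lt0 g).
  + by move=> b c; have [|[/gI|]] := lt0_tot (g b) (g c); tauto.
  + move=> b Kb; apply: (amin (g b) (proj2_sig (f b))); apply: (le_card_trans Kb).
    exists (fun c => exist (fun d => lt0 d (g b)) (g (proj1_sig c)) (proj2_sig c)).
    move=> [c hc] [d hd] /= e; apply: eq_exist; apply: gI; exact: (f_equal (@proj1_sig _ _) e).
- apply: (initial lt0) => // a Ka; apply: N; by exists a.
Qed.

(** * Pairs, finite lists and independent families on an infinite cardinal; transfinite recursion *)

Lemma le_card_bool {K : Type} : le_card nat K -> le_card bool K.
Proof.
move=> [i iI]; exists (fun b : bool => if b then i 0%nat else i 1%nat).
by move=> [] [] // /iI.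
Qed.

(** A pair is a function on [bool], and [bool] is smaller than the infinite [K]. *)
Lemma kappa_eq_kappa_lt_square (K : Type) : kappa_eq_kappa_lt K -> le_card (K * K) K.
Proof.
move=> [natK hK]; have [i iI] := natK.
have lt2 : lt_card bool K.
  split; first exact: le_card_bool.
  move=> [f fI].
  have e (m n : nat) : m <> n -> f (i m) <> f (i n) by move=> mn /fI/iI.
  move: (e 0 1 (n_Sn 0)) (e 0 2 (O_S 1)) (e 1 2 (n_Sn 1))%nat.
  by case: (f _); case: (f _); case: (f _) ; congruence.
apply: le_card_trans (hK _ lt2).
exists (fun p (b : bool) => if b then p.1 else p.2) => -[a b] [a' b'] e.
by rewrite (f_equal (fun f => f true) e : a = a') (f_equal (fun f => f false) e : b = b').
Qed.

(** Lists are folded with the pairing function. The fold alone may confuse lists of different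
    lengths, so the length is stored beside it. *)
Lemma le_card_list_self {K : Type} :
  le_card nat K -> le_card (K * K) K -> le_card (list K) K.
Proof.
move=> natK [p pI]; have [i _] := natK.
pose enc := fix enc (l : list K) := if l is k :: l' then p (k, enc l') else i 0%nat.
suff h : le_card (list K) (nat * K).
  apply: (le_card_trans h); apply: (@le_card_trans _ (K * K)); last by exists p.
  by apply: le_card_prod => //; exists (fun k => k).
exists (fun l => (length l, enc l)).
elim=> [|k l IH] [|k' l'] //= [sz /pI [-> e]].
by rewrite (IH l') // sz e.
Qed.

(* The Fichtenholz-Kantorovich-Hausdorff construction: a label codes a finite
   list F of points together with a finite list G of patterns on F, and S
   accepts it when its restriction to F is one of the patterns. *)
Lemma exists_independent_family (K : Type) :
  le_card nat K -> le_card (K * K) K ->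
  exists s : (K -> bool) -> K -> bool,
    forall (l : list (K -> bool)) (phi : (K -> bool) -> bool),
      exists j : K -> K, (forall k k', j k = j k' -> k = k') /\
        forall k S, In S l -> s S (j k) = phi S.
Proof.
move=> natK KK; have listK := le_card_list_self natK KK.
have boolK := le_card_bool natK; have [i _] := natK.
have [f fI] : le_card (list K * list (list bool) * K) K.
  apply: (le_card_trans _ KK); apply: le_card_prod; last by exists (fun k => k).
  apply: (le_card_trans _ KK); apply: le_card_prod => //.
  apply: (le_card_trans _ listK); apply: le_card_list; apply: (le_card_trans _ listK).
  exact: le_card_list.
have [g gK] := le_card_retraction (nil, nil, i 0%nat) f fI.
exists (fun S k => `[< In (List.map S (g k).1.1) (g k).1.2 >]) => l phi.
(* [d S T] is a point at which [S] and [T] differ, whenever they are distinct. *)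
have [d dP] : exists d : (K -> bool) -> (K -> bool) -> K,
    forall S T, S (d S T) = T (d S T) -> S = T.
  exists (fun S T => epsilon (inhabits (i 0%nat)) (fun k => S k <> T k)) => S T.
  apply: contraPP => ST; apply: (epsilon_spec _ (fun k => S k <> T k)).
  by apply: not_all_ex_not => e; apply: ST; apply: funext.
(* [F] contains a distinguishing point for every pair from [l], so members of [l] with the same
   trace on [F] are equal; [G] lists the traces of those that [phi] accepts. *)
pose F := flat_map (fun S => List.map (d S) l) l.
pose G := List.map (fun S => List.map S F) (List.filter phi l).
(* The third coordinate of a label is idle in the acceptance test: it repeats every label [K] many
   times, which makes [j] injective. *)
exists (fun k => f (F, G, k)); split=> [k k' /fI[]//|k S Sl].
rewrite gK /=; apply/asboolP/idP => [|pS]; last first.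
  by apply: (in_map (fun S => List.map S F)); apply/filter_In.
move=> /in_map_iff[T [e /filter_In[Tl pT]]].
suff <- : T = S by [].
apply: dP; apply: (ext_in_map e); apply/in_flat_map.
by exists T; split=> //; apply: in_map.
Qed.

(** Recursive choice where the requirement at [a] depends only on earlier values. The conclusion is
    conditional, so that solvability at [a] can be proved afterwards, by induction, from what the
    earlier values satisfy. *)
Lemma well_founded_choice (K T : Type) (t0 : T) (lt : K -> K -> Prop)
    (P : K -> (K -> T) -> T -> Prop) :
  well_founded lt ->
  (forall a w w' t, (forall b, lt b a -> w b = w' b) -> P a w t -> P a w' t) ->
  exists w, forall a, (exists t, P a w t) -> P a w (w a).
Proof.
move=> wf PE.
pose ext a (r : forall b, lt b a -> T) b :=
  (* The default [t0] off the initial segment is harmless, since [P a] does not see those values. *)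
  if excluded_middle_informative (lt b a) is left h then r b h else t0.
pose F a r := epsilon (inhabits t0) (P a (ext a r)).
pose w := Fix wf (fun _ => T) F.
have wE a : w a = F a (fun b _ => w b).
  apply: (Fix_eq wf (fun _ => T) F) => b r r' rr'; rewrite /F; congr epsilon.
  congr P; apply: funext => c; rewrite /ext.
  by case: excluded_middle_informative.
exists w => a [t Pt]; rewrite wE.
have extE b : lt b a -> ext a (fun b _ => w b) b = w b.
  by rewrite /ext; case: excluded_middle_informative.
apply: (PE a (ext a (fun b _ => w b))) => //; apply: epsilon_spec.
by exists t; apply: PE Pt => b /extE.
Qed.

(** * Clopen sets, compactness and separation *)

Lemma open_ext {X : TopSpace} (U V : X -> Prop) :
  (forall x, U x <-> V x) -> open U -> open V.
Proof. by move=> UV; have -> : U = V by apply: funext => x; apply: propext. Qed.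

Lemma open_exists {X : TopSpace} (I : Type) (O : I -> X -> Prop) :
  (forall i, open (O i)) -> open (fun x => exists i, O i x).
Proof.
move=> Oo; apply: open_ext (open_union X (fun U => exists i, U = O i) _).
  move=> x; split=> [[_ [[i ->] ix]]|[i ix]]; first by exists i.
  by exists (O i); split=> //; exists i.
by move=> _ [i ->].
Qed.

Lemma open_const (X : TopSpace) (P : Prop) : open (fun _ : X => P).
Proof.
apply: open_ext (open_exists P (fun _ _ => True) (fun _ => open_full X)) => x.
by split=> [[]|p] //; exists p.
Qed.

Lemma open_or {X : TopSpace} (U V : X -> Prop) :
  open U -> open V -> open (fun x => U x \/ V x).
Proof.
move=> Uo Vo; apply: open_ext (open_exists bool (fun b => if b then U else V) _).
  move=> x; split=> [[[] h]|[h|h]]; [by left|by right|by exists true|by exists false].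
by case.
Qed.

Lemma clopen_const (X : TopSpace) (P : Prop) : clopen (fun _ : X => P).
Proof. by split; apply: open_const. Qed.

Lemma clopen_not {X : TopSpace} (U : X -> Prop) : clopen U -> clopen (fun x => ~ U x).
Proof.
move=> [Uo Uc]; split=> //; apply: open_ext Uo => x.
by split=> [h|/NNPP//]; apply.
Qed.

Lemma clopen_and {X : TopSpace} (U V : X -> Prop) :
  clopen U -> clopen V -> clopen (fun x => U x /\ V x).
Proof.
move=> [Uo Uc] [Vo Vc]; split; first exact: open_inter.
by apply: open_ext (open_or _ _ Uc Vc) => x; tauto.
Qed.

Lemma clopen_or {X : TopSpace} (U V : X -> Prop) :
  clopen U -> clopen V -> clopen (fun x => U x \/ V x).
Proof.
move=> [Uo Uc] [Vo Vc]; split; first exact: open_or.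
by apply: open_ext (open_inter _ _ _ Uc Vc) => x; tauto.
Qed.

Lemma clopen_exists_list {X : TopSpace} (I : Type) (O : I -> X -> Prop) (l : list I) :
  (forall i, In i l -> clopen (O i)) -> clopen (fun x => exists i, In i l /\ O i x).
Proof.
elim: l => [_|i l IH h].
  have -> : (fun x => exists i, In i nil /\ O i x) = (fun _ : X => False).
    by apply: funext => x; apply: propext; split=> [[? []]|].
  exact: clopen_const.
have -> : (fun x => exists j, In j (i :: l) /\ O j x) =
          (fun x => O i x \/ exists j, In j l /\ O j x).
  apply: funext => x; apply: propext; split.
    by move=> [j [[->|jl] jx]]; [left|right; exists j].
  by move=> [ix|[j [jl jx]]]; [exists i|exists j]; split=> //; [left|right].
apply: clopen_or; first by apply: h; left.
by apply: IH => j jl; apply: h; right.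
Qed.

(** The complement of [C] is added to the cover and dropped from the finite subcover, keeping
    indices instead of sets. *)
Lemma compact_closed_finite_subcover {X : TopSpace} (C : X -> Prop) (I : Type)
    (O : I -> X -> Prop) :
  compact X -> closed C -> (forall i, open (O i)) ->
  (forall x, C x -> exists i, O i x) ->
  exists l : list I, forall x, C x -> exists i, In i l /\ O i x.
Proof.
move=> cX Cc Oo cov.
have [|x|L [LF Lcov]] := cX (fun U => U = (fun x => ~ C x) \/ exists i, U = O i).
- by move=> _ [->//|[i ->]].
- case: (classic (C x)) => [/cov[i ix]|nC].
    by exists (O i); split=> //; right; exists i.
  by exists (fun x => ~ C x); split=> //; left.
have [l lP] : exists l : list I, forall U x, In U L -> U x -> C x ->
    exists i, In i l /\ O i x.
  elim: L LF {Lcov} => [_|U L IH LF]; first by exists nil.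
  have [V VL|l lP] := IH; first by apply: LF; right.
  have [UC|[i Ui]] := LF U (or_introl erefl).
    exists l => V x [<-|]; last exact: lP.
    by rewrite UC.
  exists (i :: l) => V x [<- Ux _|VL Vx Cx]; first by exists i; split; [left|rewrite -Ui].
  by have [j [jl jx]] := lP V x VL Vx Cx; exists j; split=> //; right.
exists l => x Cx; have [U [UL Ux]] := Lcov x; exact: lP Ux Cx.
Qed.

Lemma exists_clopen_between {X : TopSpace} (C O : X -> Prop) :
  compact X -> zero_dimensional X -> closed C -> open O -> (forall x, C x -> O x) ->
  exists E, clopen E /\ (forall x, C x -> E x) /\ forall x, E x -> O x.
Proof.
move=> cX [_ zX] Cc Oo CO.
pose I := {E : X -> Prop | clopen E /\ forall y, E y -> O y}.
have [[E [[Eo _] _]] //|x /CO Ox|l lP] :=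
    compact_closed_finite_subcover C I (fun E => proj1_sig E) cX Cc.
  have [E [Ec [Ex EO]]] := zX O x Oo Ox.
  by exists (exist _ E (conj Ec EO)).
exists (fun x => exists E, In E l /\ proj1_sig E x); split; last split=> //.
  by apply: clopen_exists_list => -[E [Ec EO]].
by move=> x [[E [Ec EO]] [_ Ex]]; exact: (EO x Ex).
Qed.

Lemma open_set_neq (c : R) : open_set (fun r => r <> c).
Proof.
move=> r rc; have d : (0 < Rabs (r - c))%R by apply: Rabs_pos_lt; lra.
exists (mkposreal _ d) => s; rewrite /disc /= => rs sc; rewrite sc in rs.
by rewrite Rabs_minus_sym in rs; lra.
Qed.

Lemma continuous_indicator {X : TopSpace} (A : X -> Prop) :
  clopen A ->
  exists f : X -> R, continuous_real f /\ bounded_real f /\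
    (forall x, A x -> f x = 1%R) /\ forall x, ~ A x -> f x = 0%R.
Proof.
move=> [Ao Ac]; exists (fun x => if excluded_middle_informative (A x) then 1%R else 0%R).
split; last split; last by split=> x h; case: excluded_middle_informative.
- move=> W _; apply: (open_ext (fun x => (W 1%R /\ A x) \/ (W 0%R /\ ~ A x))).
    by move=> x; case: excluded_middle_informative => h /=; tauto.
  by apply: open_or; apply: open_inter => //; apply: open_const.
- exists 1%R => x; case: excluded_middle_informative => h; rewrite ?Rabs_R0 ?Rabs_R1; lra.
Qed.

(** The indicator of [U] is continuous on the disjoint union of [U] and [V], so it extends to some
    [g] on [X]; a clopen set is then placed between the closed set [g = 1] and the open set
    [g <> 0]. *)
Lemma F_kappa_separation {X : TopSpace} (K : Type) (U V : X -> Prop) :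
  compact X -> F_kappa_space X K -> open U -> open V ->
  type_lt X (fun x => U x \/ V x) K -> (forall x, ~ (U x /\ V x)) ->
  exists E, clopen E /\ (forall x, U x -> E x) /\ forall x, V x -> ~ E x.
Proof.
move=> cX [zX FX] Uo Vo tUV UV.
have [|f [fc [fb [f1 f0]]]] :=
    @continuous_indicator (subspace X (fun x => U x \/ V x)) (fun y => U (proj1_sig y)).
  split; first by exists U.
  exists V; split=> // -[x /= UVx]; have := UV x; tauto.
have [g [gc gf]] := FX _ (open_or _ _ Uo Vo) tUV f fc fb.
have [|||E [Ec [gE Eg]]] :=
    exists_clopen_between (fun x => g x = 1%R) (fun x => g x <> 0%R) cX zX.
- exact: (gc _ (open_set_neq 1)).
- exact: (gc _ (open_set_neq 0)).
- by move=> x ->; lra.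
exists E; split=> //; split=> x hx.
  by apply: gE; rewrite (gf (exist _ x (or_introl hx))) f1.
move=> /Eg; apply; rewrite (gf (exist _ x (or_intror hx))) f0 //= => Ux.
exact: (UV x).
Qed.

(** * Clopen sets missing the point [x], and the transfinite construction *)

Lemma hausdorff_open_neq {X : TopSpace} (x : X) : hausdorff X -> open (fun y => y <> x).
Proof.
move=> hX.
pose I := {U : X -> Prop | open U /\ ~ U x}.
apply: (open_ext (fun y => exists U : I, proj1_sig U y)).
  move=> y; split=> [[[U [Uo Ux]] /= Uy] yx|/hX[U [V [Uo [Vo [Uy [Vx UV]]]]]]].
    by apply: Ux; rewrite -yx.
  by exists (exist _ U (conj Uo (fun Ux => UV x (conj Ux Vx)))).
by apply: open_exists => -[U [Uo Ux]].
Qed.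

(** The complements of the [D i] all contain [x], so by the [G_κ] property their intersection
    contains a nonempty open set. Without isolated points this set is not just [{x}], and a small
    clopen set inside it avoids [x]. *)
Lemma exists_clopen_outside {X : TopSpace} (K : Type) (x : X) (I : Type) (D : I -> X -> Prop) :
  kappa_Parovicenko X K -> lt_card I K ->
  (forall i, clopen (D i)) -> (forall i, ~ D i x) ->
  exists W, clopen W /\ (exists y, W y) /\ ~ W x /\ forall y i, W y -> ~ D i y.
Proof.
move=> [_ [hX [[_ zX] [_ [GX isoX]]]]] IK Dc Dx.
have [|| V [Vo [[y Vy] VD]]] := GX I (fun i z => ~ D i z) IK.
- by move=> i; have [] := Dc i.
- by exists x.
have [y' [Vy' y'x]] : exists y', V y' /\ y' <> x.
  apply: NNPP => h; apply: (isoX y); apply: open_ext Vo => z.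
  have Vx z' : V z' -> z' = x by move=> ?; apply: NNPP => ?; apply: h; exists z'.
  by split=> [/Vx->|->//]; rewrite (Vx y).
have [W [Wc [Wy WV]]] := zX (fun z => V z /\ z <> x) y'
  (open_inter _ _ _ Vo (hausdorff_open_neq x hX)) (conj Vy' y'x).
exists W; split=> //; split; first by exists y'.
by split=> [/WV[]|z i /WV[/VD Dz _]].
Qed.

(** By compactness a clopen set is a finite union of members of a base of size at most κ, and finite
    lists over [K] are coded by [K]. *)
Lemma exists_clopen_enumeration {X : TopSpace} (K : Type) (x : X) :
  le_card (list K) K -> compact X -> has_weight X K ->
  exists B : K -> X -> Prop, (forall k, clopen (B k) /\ ~ B k x) /\
    forall C, clopen C -> ~ C x -> exists k, forall y, B k y <-> C y.
Proof.
move=> [c cI] cX [[Bs [[Bo Bb] [i iI]]] _].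
have [r rK] := le_card_retraction nil c cI.
pose U k y := exists k' b, In k' (r k) /\ i b = k' /\ proj1_sig b y.
(* Codes whose union is not a clopen set missing [x] are made to denote the empty set. *)
exists (fun k y => (clopen (U k) /\ ~ U k x) /\ U k y); split.
  move=> k; split; last by move=> [[_ h] /h].
  case: (classic (clopen (U k) /\ ~ U k x)) => h.
    by apply: clopen_and; [exact: clopen_const|case: h].
  have -> : (fun y => (clopen (U k) /\ ~ U k x) /\ U k y) = (fun _ => False).
    by apply: funext => y; apply: propext; split=> // -[].
  exact: clopen_const.
move=> C [Co Cc] Cx.
pose I := {b : {V | Bs V} | forall y, proj1_sig b y -> C y}.
have [|||l lP] := @compact_closed_finite_subcover X C I
    (fun b => proj1_sig (proj1_sig b)) cX.
- exact: Cc.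
- by move=> [[V BV] VC]; apply: Bo.
- move=> y Cy; have [V [BV [Vy VC]]] := Bb C y Co Cy.
  by exists (exist _ (exist _ V BV) VC).
pose k := c (List.map (fun b : I => i (proj1_sig b)) l).
have UC y : U k y <-> C y.
  rewrite /U rK; split=> [[k' [b [/in_map_iff[b' [<- _]] [/iI-> by']]]]|Cy].
    exact: (proj2_sig b').
  have [b [bl b_y]] := lP y Cy.
  exists (i (proj1_sig b)), (proj1_sig b); split=> //.
  exact: (in_map (fun b : I => i (proj1_sig b))).
have UE : U k = C by apply: funext => y; apply: propext.
by exists k => y; rewrite UE; split=> [[]|Cy].
Qed.
(* The gaps W are chosen outside everything listed before them, so that each
   B b meets few of them while every clopen partition of an initial stage can
   still be extended with W a on either side. *)
Lemma exists_free_clopen_sequence {X : TopSpace} (K : Type) (x : X)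
    (lt : K -> K -> Prop) (B : K -> X -> Prop) :
  kappa_Parovicenko X K -> well_founded lt ->
  (forall a b, lt a b \/ a = b \/ lt b a) -> (forall a, lt_card {b | lt b a} K) ->
  (forall k, clopen (B k) /\ ~ B k x) -> (forall y, y <> x -> exists k, B k y) ->
  exists W : K -> X -> Prop,
    (forall a, (exists y, W a y) /\ ~ W a x) /\
    (forall a b y, lt b a -> W a y -> ~ B b y) /\
    forall S : K -> bool, exists A : X -> Prop,
      open A /\ open (fun y => y <> x /\ ~ A y) /\
      forall a y, W a y -> (A y <-> S a = true).
Proof.
move=> PX lt_wf lt_tot lt_small Bc Bcov.
have [cX [hX [zX [FX _]]]] := PX.
have [W WP] := well_founded_choice K (X -> Prop) (fun _ => False) lt
  (fun a w t => clopen t /\ (exists y, t y) /\ ~ t x /\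
     forall b y, lt b a -> t y -> ~ (B b y \/ w b y)) lt_wf
  (fun a w w' t ww' h =>
     let: conj h1 (conj h2 (conj h3 h4)) := h in
     conj h1 (conj h2 (conj h3 (fun b y ba => eq_ind (w b) (fun V => t y -> ~ (B b y \/ V y))
       (h4 b y ba) (w' b) (ww' b ba))))).
have {}WP a : clopen (W a) /\ (exists y, W a y) /\ ~ W a x /\
     forall b y, lt b a -> W a y -> ~ (B b y \/ W b y).
  elim/(well_founded_ind lt_wf): a => a IH; apply: WP.
  have [||V [Vc [Vn [Vx VD]]]] := exists_clopen_outside K x {b | lt b a}
     (fun b y => B (proj1_sig b) y \/ W (proj1_sig b) y) PX (lt_small a).
  - by move=> [b /= /IH[Wc _]]; apply: clopen_or => //; have [] := Bc b.
  - by move=> [b /= /IH[_ [_ [Wx _]]]]; have [] := Bc b; tauto.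
  exists V; split=> //; split=> //; split=> // b y ba Vy.
  exact: (VD y (exist _ b ba) Vy).
exists W; split; first by move=> a; have [_ [? []]] := WP a.
split; first by move=> a b y ba Way Bby; have [_ [_ [_ /(_ b y ba Way)]]] := WP a; tauto.
move=> S; pose D a y := B a y \/ W a y.
have Dc a : clopen (D a) by apply: clopen_or; [case: (Bc a)|case: (WP a)].
have Dx a : ~ D a x by have := Bc a; have := WP a; rewrite /D; tauto.
(* [c a] is the future trace of [A] on [D a]: it obeys [S] on [W a] and agrees with each earlier
   [c b] on the overlap of [D a] and [D b]. *)
have [c cP] := well_founded_choice K (X -> Prop) (fun _ => False) lt
  (fun a w t => clopen t /\ (forall y, t y -> D a y) /\ (forall y, W a y -> (t y <-> S a = true)) /\
     forall b y, lt b a -> D b y -> D a y -> (t y <-> w b y)) lt_wf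
  (fun a w w' t ww' h =>
     let: conj h1 (conj h2 (conj h3 h4)) := h in
     conj h1 (conj h2 (conj h3 (fun b y ba => eq_ind (w b) (fun V => D b y -> D a y -> (t y <-> V y))
       (h4 b y ba) (w' b) (ww' b ba))))).
have {}cP a : clopen (c a) /\ (forall y, c a y -> D a y) /\
     (forall y, W a y -> (c a y <-> S a = true)) /\
     forall b y, lt b a -> D b y -> D a y -> (c a y <-> c b y).
  elim/(well_founded_ind lt_wf): a => a IH; apply: cP.
  (* [U] and [V] collect the points already put inside and outside [A]. Together they fill the
     earlier [D b], a union of fewer than κ clopen sets, and coherence makes them disjoint, so a
     clopen [E] separates them. *)
  pose U y := exists b : {b | lt b a}, c (proj1_sig b) y.
  pose V y := exists b : {b | lt b a}, D (proj1_sig b) y /\ ~ c (proj1_sig b) y.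
  have cD (b : {b | lt b a}) : clopen (c (proj1_sig b)) by case: b => b /= /IH[].
  have [||||E [Ec [UE VE]]] := F_kappa_separation K U V cX FX.
  - by apply: open_exists => b; have [] := cD b.
  - by apply: open_exists => b; have [_ ?] := cD b; apply: open_inter => //; have [] := Dc (proj1_sig b).
  - exists {b | lt b a}, (fun b => D (proj1_sig b)); split=> //; split=> [b|y]; first exact: Dc.
    split=> [[[[b ba] /= cb]|[b [Db _]]]|[b Db]]; [|by exists b|].
      by have [_ [cDb _]] := IH b ba; exists (exist _ b ba); apply: cDb.
    by case: (classic (c (proj1_sig b) y)) => h; [left|right]; exists b.
  - move=> y [[[b ba] /= cb] [[d da] /= [Dd ncd]]].
    have [_ [bD [_ bP]]] := IH b ba; have [_ [_ [_ dP]]] := IH d da.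
    have [bd|[bd|db]] := lt_tot b d.
    + by apply: ncd; apply/(dP b y bd (bD y cb) Dd).
    + by apply: ncd; rewrite -bd.
    + by apply: ncd; apply/(bP d y db Dd (bD y cb)).
  (* Follow [E] off [W a] and [S] on [W a]; there is no conflict, because [W a] misses every earlier
     [D b]. *)
  exists (fun y => D a y /\ ((E y /\ ~ W a y) \/ (W a y /\ S a = true))).
  have [Wac [_ [_ Wa]]] := WP a.
  split; last split; last split.
  - apply: clopen_and => //; apply: clopen_or; apply: clopen_and => //.
      exact: clopen_not.
    exact: clopen_const.
  - by move=> y [].
  - by move=> y Way; rewrite /D; tauto.
  - move=> b y ba Dby Day; have nW : ~ W a y by move/(Wa b y ba).
    have := UE y; have := VE y => hV hU; split=> [[_ [[Ey _]|[/nW]]]|cb] //.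
      by apply: NNPP => ncb; apply: (hV _ Ey); exists (exist _ b ba).
    split=> //; left; split=> //; apply: hU; by exists (exist _ b ba).
have cc a b y : c a y -> D b y -> c b y.
  move=> ca Db; have [_ [aD [_ aP]]] := cP a; have [_ [_ [_ bP]]] := cP b.
  have [ab|[<-//|ba]] := lt_tot a b; first by apply/(bP a y ab (aD y ca) Db).
  by apply/(aP b y ba Db (aD y ca)).
exists (fun y => exists a, c a y); split; last split.
- by apply: open_exists => a; case: (cP a) => -[].
(* The [D a] cover the complement of [x], and by [cc] a point outside one [c a] with [D a] around it
   is outside all of them. *)
- apply: (open_ext (fun y => exists a, D a y /\ ~ c a y)).
    move=> y; split=> [[a [Da nca]]|[yx nA]].
      by split=> [yx|[b cb]]; [apply: (Dx a); rewrite -yx|apply: nca; exact: (cc b)].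
    by have [k Bk] := Bcov y yx; exists k; split=> [|ck]; [left|apply: nA; exists k].
  by apply: open_exists => a; case: (cP a) => -[_ ?] _; apply: open_inter => //; case: (Dc a).
- move=> a y Way; have [_ [_ [/(_ y Way)<- _]]] := cP a.
  by split=> [[b cb]|ca]; [apply: (cc b) => //; right|exists a].
Qed.

(** * Lower bound: realising every pattern in the remainder *)

Lemma well_founded_asym {K : Type} (lt : K -> K -> Prop) :
  well_founded lt -> forall a b, lt a b -> ~ lt b a.
Proof.
by move=> wf; elim/(well_founded_ind wf) => a IH b ab ba; exact: (IH b ba a).
Qed.

(** If transitivity failed, trichotomy would give a cycle of length two or three, against
    well-foundedness. *)
Lemma well_founded_total_trans (K : Type) (lt : K -> K -> Prop) :
  well_founded lt -> (forall a b, lt a b \/ a = b \/ lt b a) ->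
  forall a b c, lt a b -> lt b c -> lt a c.
Proof.
move=> wf tot a b c ab bc.
have no3 d : forall d' d'', lt d d' -> lt d' d'' -> ~ lt d'' d.
  elim/(well_founded_ind wf): d => d IH d' d'' h h' h''; exact: (IH d'' h'' d d').
have [//|[ac|ca]] := tot a c; first by case: (well_founded_asym lt wf a b ab); rewrite ac.
by case: (no3 a b c).
Qed.

(** An injective image of [K] is too large to stay within one initial segment, so [j] passes the
    greatest element of [l]. *)
Lemma exists_above_list {K : Type} (lt : K -> K -> Prop) :
  le_card nat K -> le_card (K * K) K -> well_founded lt ->
  (forall a b, lt a b \/ a = b \/ lt b a) -> (forall a, lt_card {b | lt b a} K) ->
  forall (j : K -> K) (l : list K), (forall k k', j k = j k' -> k = k') ->
    exists k, forall a, In a l -> lt a (j k).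
Proof.
move=> natK KK lt_wf lt_tot lt_small j l jI; have [i _] := natK.
have lt_tr := well_founded_total_trans K lt lt_wf lt_tot.
have irrefl a : ~ lt a a by move=> aa; exact: (well_founded_asym lt lt_wf a a).
have [g gP] : exists g, forall a, In a l -> ~ lt g a.
  elim: l => [|a l [g gP]]; first by exists (i 0%nat).
  have [ag|[ag|ga]] := lt_tot a g.
  - by exists g => b [<- ga|/gP//]; apply: (irrefl g); apply: lt_tr ag.
  - by exists g => b [<-|/gP//]; rewrite ag.
  - by exists a => b [<-|/gP gb ab]; [|apply: gb; apply: lt_tr ab].
suff [k gk] : exists k, lt g (j k).
  exists k => a /gP ga; have [//|[ajk|jka]] := lt_tot a (j k); case: ga.
    by rewrite ajk.
  exact: lt_tr jka.
apply: NNPP => h.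
have [f fI] : le_card (bool * K) K.
  apply: (le_card_trans _ KK); apply: le_card_prod; last by exists (fun k => k).
  exact: le_card_bool.
(* Doubling K leaves a full copy of it on which j avoids g itself. *)
have [b hb] : exists b, forall k, j (f (b, k)) <> g.
  apply: NNPP => N; have N' := not_ex_all_not _ _ N.
  have /not_all_ex_not[k1 /NNPP e1] := N' true.
  have /not_all_ex_not[k2 /NNPP e2] := N' false.
  by have := fI _ _ (jI _ _ (eq_trans e1 (esym e2))).
have [_] := lt_small g; apply.
have hlt k : lt (j (f (b, k))) g.
  have [//|[/hb//|lg]] := lt_tot (j (f (b, k))) g.
  by case: h; exists (f (b, k)).
exists (fun k => exist (fun c => lt c g) (j (f (b, k))) (hlt k)) => k k' H.
by have /jI/fI[] := f_equal (@proj1_sig _ _) H.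
Qed.

Lemma le_card_remainder {X : TopSpace} (K : Type) (x : X) (Z : TopSpace)
    (e : subspace X (fun y => y <> x) -> Z) :
  kappa_eq_kappa_lt K -> kappa_Parovicenko X K -> has_weight X K ->
  is_stone_cech (subspace X (fun y => y <> x)) Z e ->
  le_card ((K -> bool) -> bool) {z : Z | forall y, e y <> z}.
Proof.
move=> hK PX wX [cZ [_ [_ [_ [eo [_ eext]]]]]].
have KK := kappa_eq_kappa_lt_square K hK; have [natK _] := hK.
have [cX [hX [[_ zX] _]]] := PX.
have [lt [lt_wf [lt_tot lt_small]]] := exists_initial_well_order K.
have [B [Bc BP]] := exists_clopen_enumeration K x (le_card_list_self natK KK) cX wX.
have Bcov y : y <> x -> exists k, B k y.
  move=> yx; have [C [Cc [Cy Cx]]] := zX _ y (hausdorff_open_neq x hX) yx.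
  have [|k kP] := BP C Cc; first by move/Cx.
  by exists k; apply/kP.
have [W [Wn [WB WA]]] :=
  exists_free_clopen_sequence K x lt B PX lt_wf lt_tot lt_small Bc Bcov.
have [s sP] := exists_independent_family K natK KK.
pose Y := subspace X (fun y => y <> x).
have /(_ _)/constructive_indefinite_description A' := WA _.
pose A S := proj1_sig (A' (s S)).
have AP S : open (A S) /\ open (fun y => y <> x /\ ~ A S y) /\
    forall a y, W a y -> (A S y <-> s S a = true) by exact: proj2_sig (A' (s S)).
have Ac S : clopen (fun y : Y => A S (proj1_sig y)).
  have [Ao [nAo _]] := AP S; split; first by exists (A S).
  exists (fun y => y <> x /\ ~ A S y); split=> // -[y yx] /=; tauto.
(* [g S] extends the indicator of [A S] to [Z]; its values at remainder points encode the
   patterns. *)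
have [g gP] : exists g : (K -> bool) -> Z -> R, forall S, continuous_real (g S) /\
    forall y, g S (e y) = (if `[< A S (proj1_sig y) >] then 1 else 0)%R.
  apply: (choice (fun S (g : Z -> R) => continuous_real g /\ forall y, g (e y) = _)) => S.
  have [f [fc [fb [f1 f0]]]] := continuous_indicator _ (Ac S).
  have [g [gc gf]] := eext f fc fb; exists g; split=> // y; rewrite gf.
  by case: asboolP => [/f1|/f0].
(* [G k] is open in [Z] with trace [B k]. Since the [B k] cover the complement of [x], a point
   outside all [G k] lies in the remainder. *)
have [G GP] : exists G : K -> Z -> Prop, forall k, open (G k) /\
    forall y, B k (proj1_sig y) <-> G k (e y).
  apply: (choice (fun k (G : Z -> Prop) => open G /\ forall y, _ <-> G (e y))) => k.
  by apply: eo; exists (B k); split; [case: (Bc k) => -[]|].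
pose v (b : bool) : R := if b then 1%R else 0%R.
have zP phi : exists z, (forall y, e y <> z) /\ forall S, g S z = v (phi S).
  (* If no remainder point realised [phi], these open sets would cover [Z]: each point would have a
     wrong value of some [g T] or lie in some [G k]. *)
  pose O (i : (K -> bool) + K) z :=
    match i with inl T => g T z <> v (phi T) | inr k => G k z end.
  apply: NNPP => N.
  have [|||l lP] := @compact_closed_finite_subcover Z (fun _ => True) _ O cZ.
  - exact: open_const.
  - move=> [S|k]; last by case: (GP k).
    by have [gc _] := gP S; exact: (gc _ (open_set_neq (v (phi S)))).
  - move=> z _; apply: NNPP => nO; apply: N; exists z; split=> [y yz|S].
      have [k Bk] := Bcov _ (proj2_sig y).
      by apply: nO; exists (inr k); rewrite /= -yz; apply/(proj2 (GP k)).
    by apply: NNPP => gS; apply: nO; exists (inl S).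
  pose lS := flat_map (fun i : (K -> bool) + K => if i is inl T then T :: nil else nil) l.
  have [j [jI jP]] := sP lS phi.
  pose lK := flat_map (fun i : (K -> bool) + K => if i is inr k then k :: nil else nil) l.
  (* A point of [W (j k)] escapes the finite subcover: independence gives it the values [phi T] for
     [T] in [lS], and [j k] lies above all of [lK], so it is in none of those [B k']. *)
  have [k kP] := exists_above_list lt natK KK lt_wf lt_tot lt_small j lK jI.
  have [[y Wy] Wx] := Wn (j k).
  have yx : y <> x by move=> yx; apply: Wx; rewrite -yx.
  have [[T|k'] [il]] := lP (e (exist _ y yx)) I.
  - apply; have [_ ->] := gP T; have [_ [_ /(_ _ y Wy) AT]] := AP T.
    have Tl : In T lS by apply/in_flat_map; exists (inl T); split=> //; left.
    by move: AT; rewrite (jP k T Tl) /v; case: asboolP; case: (phi T) => //=; intuition.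
  - rewrite /= -(proj2 (GP k')) /=; apply: (WB (j k)) => //; apply: kP.
    by apply/in_flat_map; exists (inr k'); split=> //; left.
(* Chosen points for different patterns differ, because [phi] is read off from the values of the
   [g S]. *)
exists (fun phi => let h := constructive_indefinite_description _ (zP phi) in
  exist _ (proj1_sig h) (proj1 (proj2_sig h))) => phi phi' /(f_equal (@proj1_sig _ _)) /=.
case: constructive_indefinite_description => z [/= _ zphi].
case: constructive_indefinite_description => z' [/= _ zphi'] zz'.
apply: funext => S; have := zphi S; rewrite zz' zphi' /v.
case: (phi S) (phi' S) => [] [] //; lra.
Qed.

(** * Upper bound: counting points by traces on a dense set *)

(** One point other than [x] is picked from each base set, with default [y0] where there is none;
    [y0] exists because [x] is not isolated. *)
Lemma exists_dense_family {X : TopSpace} (K : Type) (x : X) :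
  has_weight X K -> hausdorff X -> ~ isolated x ->
  exists d : K -> subspace X (fun y => y <> x),
    forall (V : subspace X (fun y => y <> x) -> Prop),
      open V -> (exists y, V y) -> exists k, V (d k).
Proof.
move=> [[Bs [[Bo Bb] [i iI]]] _] hX xN.
have [y0 y0x] : exists y, y <> x.
  apply: NNPP => h; apply: xN; apply: open_ext (open_full X) => y.
  by split=> // _; apply: NNPP => yx; apply: h; exists y.
have [b0 [Bb0 _]] := Bb _ y0 (open_full X) I.
have [U UP] := le_card_retraction (exist _ b0 Bb0) i iI.
pose Y := subspace X (fun y => y <> x).
exists (fun k => epsilon (inhabits (exist _ y0 y0x : Y))
  (fun y => proj1_sig (U k) (proj1_sig y))) => V [O [Oo VO]] [y Vy].
have [B [BB [By BO]]] := Bb O (proj1_sig y) Oo (proj1 (VO y) Vy).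
exists (i (exist _ B BB)); apply/VO; apply: BO; rewrite UP.
apply: (epsilon_spec (inhabits (exist _ y0 y0x : Y)) (fun y : Y => B (proj1_sig y))).
by exists y.
Qed.

(** Send [z] to the family of all [T] for which [z] is in the closure of the points [e (d k)] with
    [k] in [T]. *)
Lemma le_card_of_dense {Y Z : TopSpace} (K : Type) (e : Y -> Z) (d : K -> Y) :
  hausdorff Z -> (forall W, open W -> open (fun y => W (e y))) ->
  (forall W : Z -> Prop, open W -> (exists z, W z) -> exists y, W (e y)) ->
  (forall V : Y -> Prop, open V -> (exists y, V y) -> exists k, V (d k)) ->
  le_card Z ((K -> bool) -> bool).
Proof.
move=> hZ ec ed dd.
exists (fun z T => `[< forall W : Z -> Prop, open W -> W z ->
  exists k, T k = true /\ W (e (d k)) >]) => z z' zz'; apply: NNPP => /hZ[U [V [Uo [Vo [Uz [Vz' UV]]]]]].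
(* For disjoint neighbourhoods [U] of [z] and [V] of [z'], the index set of the dense points in [U]
   belongs to the family of [z] but not to that of [z']. *)
have zU : `[< forall W : Z -> Prop, open W -> W z ->
    exists k, `[< U (e (d k)) >] = true /\ W (e (d k)) >].
  apply/asboolP => W Wo Wz.
  have [|y UWy] := ed _ (open_inter _ _ _ Uo Wo); first by exists z.
  have [|k [Uk Wk]] := dd _ (ec _ (open_inter _ _ _ Uo Wo)); first by exists y.
  by exists k; split=> //; apply/asboolP.
have := f_equal (fun F => F (fun k => `[< U (e (d k)) >])) zz'; rewrite /= zU => /esym/asboolP h.
have [k [/asboolP Uk Vk]] := h V Vo Vz'; exact: (UV (e (d k))).
Qed.

Theorem theorem7p4 (K : Type) (X : TopSpace) :
  kappa_eq_kappa_lt K ->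
  kappa_Parovicenko X K -> has_weight X K ->
  forall (x : X) (Z : TopSpace) (e : subspace X (fun y => y <> x) -> Z),
    is_stone_cech (subspace X (fun y => y <> x)) Z e ->
    eq_card {z : Z | forall y, e y <> z} ((K -> bool) -> bool).
Proof.
move=> hK PX wX x Z e bZ; apply: le_card_antisym; last exact: le_card_remainder bZ.
have [_ [hX [_ [_ [_ isoX]]]]] := PX; have [_ [hZ [_ [ec [_ [ed _]]]]]] := bZ.
have [d dd] := exists_dense_family K x wX hX (isoX x).
exact: (le_card_trans (le_card_subset _ _) (le_card_of_dense K e d hZ ec ed dd)).
Qed.
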